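(* Let $\tau>0$, $M\ge0$, $\ell\ge1$, and let a quadrature rule on $[0,1]$ with distinct points $\widehat\xi_i$ and positive weights $\widehat\omega_i>0$, $i=1,\dots,Q$, be given which is exact to degree $2\ell-1$. Let discrete closed curves $\Gamma_h^m=\boldsymbol Y_h^m(\widehat\Gamma_h)$ of degree $\ell$ be generated from a given $\boldsymbol Y_h^0$ as follows: for each $m=0,\dots,M$, the curve $\Gamma_h^m$ satisfies ($\mathcal A1^h$): $|\nabla\boldsymbol F_{h,j}^m(\widehat\xi_i)|>0$ for all $j=1,\dots,N$, $i=1,\dots,Q$; the pair $(\boldsymbol X_h^{m+1},\kappa_h^{m+1})\in[\mathbb V_\ell^m]^2\times\mathbb V_\ell^m$ is a solution of the nonlinear system $$\Big(\frac{\boldsymbol X_h^{m+1}-\mathrm{id}}{\tau},\varphi_h\boldsymbol n_h^{m+\frac12}\Big)^h_{\Gamma_h^m}-(\nabla_s\kappa_h^{m+1},\nabla_s\varphi_h)^h_{\Gamma_h^m}=0,\qquad (\kappa_h^{m+1}\boldsymbol n_h^{m+\frac12},\boldsymbol\eta_h)^h_{\Gamma_h^m}+(\nabla_s\boldsymbol X_h^{m+1},\nabla_s\boldsymbol\eta_h)^h_{\Gamma_h^m}=0$$ for all $\varphi_h\in\mathbb V_\ell^m$, $\boldsymbol\eta_h\in[\mathbb V_\ell^m]^2$, where $\boldsymbol Y_h^{m+1}=\boldsymbol X_h^{m+1}\circ\boldsymbol Y_h^m$ and, piecewise on each $\widehat\sigma_j$, $$\boldsymbol n_h^{m+\frac12}\circ\boldsymbol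 Y_h^m=\frac{(\partial_{\widehat{\boldsymbol\tau}}\boldsymbol Y_h^{m+1}+\partial_{\widehat{\boldsymbol\tau}}\boldsymbol Y_h^m)^\perp}{2|\partial_{\widehat{\boldsymbol\tau}}\boldsymbol Y_h^m|}.$$ Then $$L_h^{M+1}+\tau\sum_{m=0}^M(\nabla_s\kappa_h^{m+1},\nabla_s\kappa_h^{m+1})^h_{\Gamma_h^m}\le L_h^0,\qquad A_h^{M+1}=A_h^M=\cdots=A_h^1=A_h^0,$$ where $L_h^m=(1,1)^h_{\Gamma_h^m}$ is the numerical perimeter and $A_h^m=\frac12\int_{\Gamma_h^m}\mathrm{id}\cdot\boldsymbol n_h^m\,\mathrm ds=\frac12\int_{\widehat\Gamma_h}\boldsymbol Y_h^m\cdot(\partial_{\widehat{\boldsymbol\tau}}\boldsymbol Y_h^m)^\perp\,\mathrm ds$ is the area enclosed by $\Gamma_h^m$.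
   Context: Reference grid. $\widehat{\mathbb K}=[0,1]$; $\widehat\Gamma_h=\bigcup_{j=1}^N\widehat\sigma_j\subset\mathbb R^2$ is a closed polygonal curve with segments $\widehat\sigma_j=A_j(\widehat{\mathbb K})$, $A_j$ injective affine maps; $\widehat{\boldsymbol\tau}$ is the (piecewise constant) unit tangent of the oriented curve $\widehat\Gamma_h$ and $\partial_{\widehat{\boldsymbol\tau}}$ the directional derivative along it. $\mathbb P^\ell$ denotes polynomials of degree $\le\ell$. Discrete curve. $\boldsymbol Y_h^m:\widehat\Gamma_h\to\mathbb R^2$ is continuous with $\boldsymbol Y_h^m|_{\widehat\sigma_j}\in[\mathbb P^\ell(\widehat\sigma_j)]^2$ for each $j$; $\boldsymbol F_{h,j}^m=\boldsymbol Y_h^m|_{\widehat\sigma_j}\circ A_j$, and $\Gamma_h^m=\boldsymbol Y_h^m(\widehat\Gamma_h)$. Functions on $\Gamma_h^m$ are identified with their pull-backs under $\boldsymbol Y_h^m$ to $\widehat\Gamma_h$. The finite element space is $$\mathbb V_\ell^m=\{v_h\in H^1(\Gamma_h^m): v_h\circ\boldsymbol Y_h^m|_{\widehat\sigma_j}\in\mathbb P^\ell(\widehat\sigma_j),\ j=1,\dots,N\},$$ i.e. the functions whose pull-back $v_h\circ\boldsymbol Y_h^m$ is continuous on $\widehat\Gamma_h$ and polynomial of degree $\le\ell$ on each segment. $\mathrm{id}$ is the identity on $\Gamma_h^m$ (pull-back $\boldsymbol Y_h^m$). Geometry (piecewise, wherever $|\partial_{\widehat{\boldsymbol\tau}}\boldsymbol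 Y_h^m|>0$). $\boldsymbol n_h^m\circ\boldsymbol Y_h^m=(\partial_{\widehat{\boldsymbol\tau}}\boldsymbol Y_h^m)^\perp/|\partial_{\widehat{\boldsymbol\tau}}\boldsymbol Y_h^m|$, where $(\cdot)^\perp$ is rotation by a right angle, of fixed sense (chosen so that $\boldsymbol n_h^m$ is the outer normal). $\boldsymbol\tau^m$ is the unit tangent of $\Gamma_h^m$, and $\nabla_s f=(\partial_{\boldsymbol\tau^m}f)\,\boldsymbol\tau^m$ (for vector-valued $f$, $\nabla_s f=\partial_{\boldsymbol\tau^m}f\otimes\boldsymbol\tau^m$), where $(\partial_{\boldsymbol\tau^m}f)\circ\boldsymbol Y_h^m=\partial_{\widehat{\boldsymbol\tau}}(f\circ\boldsymbol Y_h^m)/|\partial_{\widehat{\boldsymbol\tau}}\boldsymbol Y_h^m|$. Quadrature. $\int^h_{\widehat{\mathbb K}}f\,\mathrm d\widehat x=\sum_{i=1}^Q f(\widehat\xi_i)\widehat\omega_i$; the rule is exact to degree $p$ if $\int^h_{\widehat{\mathbb K}}f\,\mathrm d\widehat x=\int_{\widehat{\mathbb K}}f\,\mathrm d\widehat x$ for all $f\in\mathbb P^p(\widehat{\mathbb K})$. Moreover $$(u,v)^h_{\Gamma_h^m}=\sum_{j=1}^N\sum_{i=1}^Q (u\circ\boldsymbol F_{h,j}^m)(\widehat\xi_i)\cdot(v\circ\boldsymbol F_{h,j}^m)(\widehat\xi_i)\,|\nabla\boldsymbol F_{h,j}^m(\widehat\xi_i)|\,\widehat\omega_i$$ (product, Euclidean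 or Frobenius inner product for scalars, vectors, matrices; piecewise-defined quantities are evaluated from within element $j$; $|\nabla\boldsymbol F_{h,j}^m|$ is the Euclidean norm of the derivative). *)

(* Defs.v *)
From mathcomp Require Import all_boot all_order all_algebra.
From mathcomp Require Import all_classical all_reals all_analysis.
Import Order.TTheory GRing.Theory Num.Theory numFieldNormedType.Exports.
Set Implicit Arguments.
Unset Strict Implicit.
Unset Printing Implicit Defensive.
Local Open Scope classical_set_scope.
Local Open Scope ring_scope.

Section FixedRing.
Variable R : realType.

Definition frob m n (A B : 'M[R]_(m, n)) : R :=
  \sum_(i < m) \sum_(k < n) A i k * B i k.

(* The library norm on matrices is the sup norm, hence this Euclidean one. *)
Definition enorm (u : 'rV[R]_2) : R := Num.sqrt (frob u u).

(* Rotation by a right angle, clockwise or counterclockwise. *)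
Definition perp (cw : bool) (u : 'rV[R]_2) : 'rV[R]_2 :=
  \row_k (if k == 0 then (if cw then u 0 1 else - u 0 1)
          else (if cw then - u 0 0 else u 0 0)).

(* Directional derivative at a along v, with increments restricted to stay in
   S; it only depends on f on S and becomes one-sided at an end of a segment. *)
Definition derive_in (V W : normedModType R) (S : set V) (f : V -> W)
    (a v : V) : W :=
  lim ((fun t : R => t^-1 *: (f (a + t *: v) - f a))
         @ within [set t : R | S (a + t *: v)] 0^').

(* Closed polygonal curve traversed as vtx 0 -> vtx 1 -> ... -> vtx 0; the map
   seg j parametrizes the edge from vtx j to the cyclically next vertex, possibly
   backwards. *)
Record ref_grid (N : nat) := RefGrid {
  vtx : 'I_N -> 'rV[R]_2;
  seg : 'I_N -> R -> 'rV[R]_2;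
  seg_affine : forall j, exists a b, forall x, seg j x = a + x *: b;
  seg_inj : forall j, injective (seg j);
  seg_ends : forall j,
    (seg j 0 = vtx j /\ seg j 1 = vtx (ordS j)) \/
    (seg j 0 = vtx (ordS j) /\ seg j 1 = vtx j) }.

Record quad_rule (Q : nat) := QuadRule {
  node : 'I_Q -> R;
  weight : 'I_Q -> R;
  node_in : forall i, `[0, 1]%classic (node i);
  node_inj : injective node;
  weight_gt0 : forall i, 0 < weight i }.

Definition quad Q (q : quad_rule Q) (f : R -> R) : R :=
  \sum_(i < Q) f (node q i) * weight q i.

Definition exact_to_degree Q (q : quad_rule Q) (p : nat) : Prop :=
  forall f : {poly R}, (size f <= p.+1)%N ->
    quad q (fun x => f.[x]) =
    (\int[lebesgue_measure]_(x in `[0%R, 1%R]) f.[x])%R.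

Section Grid.
Variables (N : nat) (G : ref_grid N).

Definition edge (j : 'I_N) : set 'rV[R]_2 := seg G j @` `[0, 1].

Definition ref_curve : set 'rV[R]_2 := \bigcup_j edge j.

Definition ref_tangent (j : 'I_N) : 'rV[R]_2 :=
  (enorm (vtx G (ordS j) - vtx G j))^-1 *: (vtx G (ordS j) - vtx G j).

(* A piecewise function on the curve: its value at z seen from element j. *)
Definition piecewise (W : Type) := 'I_N -> 'rV[R]_2 -> W.

Definition pw (W : Type) (f : 'rV[R]_2 -> W) : piecewise W := fun _ => f.

Definition dref (W : normedModType R) (f : 'rV[R]_2 -> W) : piecewise W :=
  fun j z => derive_in (edge j) f z (ref_tangent j).

(* Functions on a curve Y(ref_curve) are represented by their pull-backs under
   Y, so that the space does not depend on Y, the identity of the curve is Y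
   itself, and a map X of the curve into the plane is the next Y. *)
Definition fe_space (l : nat) (v : 'rV[R]_2 -> R) : Prop :=
  {within ref_curve, continuous v} /\
  forall j, exists2 p : {poly R}, (size p <= l.+1)%N &
    forall x, `[0, 1]%classic x -> v (seg G j x) = p.[x].

Definition fe_space2 (l : nat) (v : 'rV[R]_2 -> 'rV[R]_2) : Prop :=
  forall k, fe_space l (fun z => v z 0 k).

Definition element_map (Y : 'rV[R]_2 -> 'rV[R]_2) (j : 'I_N) : R -> 'rV[R]_2 :=
  Y \o seg G j.

Definition element_grad (Y : 'rV[R]_2 -> 'rV[R]_2) (j : 'I_N) (x : R) :
    'rV[R]_2 :=
  derive_in (V := R) `[0, 1] (element_map Y j) x 1.

Section Curve.
Variable Y : 'rV[R]_2 -> 'rV[R]_2.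

Definition tangent : piecewise 'rV[R]_2 :=
  fun j z => (enorm (dref Y j z))^-1 *: dref Y j z.

Definition dtangent (W : normedModType R) (f : 'rV[R]_2 -> W) : piecewise W :=
  fun j z => (enorm (dref Y j z))^-1 *: dref f j z.

Definition sgrad (f : 'rV[R]_2 -> R) : piecewise 'rV[R]_2 :=
  fun j z => dtangent (W := R) f j z *: tangent j z.

Definition sgrad2 (f : 'rV[R]_2 -> 'rV[R]_2) : piecewise 'M[R]_2 :=
  fun j z => (dtangent f j z)^T *m tangent j z.

Definition quad_ip (W : Type) (ip : W -> W -> R) Q (q : quad_rule Q)
    (u v : piecewise W) : R :=
  \sum_(j < N) quad q (fun x =>
    ip (u j (seg G j x)) (v j (seg G j x)) * enorm (element_grad Y j x)).

(* (1, 1)^h *)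
Definition perimeter_h Q (q : quad_rule Q) : R :=
  quad_ip *%R q (pw (fun=> 1)) (pw (fun=> 1)).

Definition curve_integral (g : piecewise R) : R :=
  \sum_(j < N) (\int[lebesgue_measure]_(x in `[0%R, 1%R])
    (g j (seg G j x) * enorm (seg G j 1 - seg G j 0)))%R.

Definition area (cw : bool) : R :=
  2^-1 * curve_integral (fun j z => frob (Y z) (perp cw (dref Y j z))).

Definition assumption_A1h Q (q : quad_rule Q) : Prop :=
  forall j i, 0 < enorm (element_grad Y j (node q i)).

Definition half_normal (cw : bool) (Ynew : 'rV[R]_2 -> 'rV[R]_2) :
    piecewise 'rV[R]_2 :=
  fun j z => (2 * enorm (dref Y j z))^-1 *:
               perp cw (dref Ynew j z + dref Y j z).

Definition scheme_solution (cw : bool) (l : nat) Q (q : quad_rule Q) (dt : R)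
    (Ynew : 'rV[R]_2 -> 'rV[R]_2) (kappa : 'rV[R]_2 -> R) : Prop :=
  let n := half_normal cw Ynew in
  [/\ fe_space2 l Ynew, fe_space l kappa,
      forall phi, fe_space l phi ->
        quad_ip (@frob _ _) q (pw (fun z => dt^-1 *: (Ynew z - Y z)))
                (fun j z => phi z *: n j z)
        - quad_ip (@frob _ _) q (sgrad kappa) (sgrad phi) = 0
    & forall eta, fe_space2 l eta ->
        quad_ip (@frob _ _) q (fun j z => kappa z *: n j z) (pw eta)
        + quad_ip (@frob _ _) q (sgrad2 Ynew) (sgrad2 eta) = 0].

End Curve.
End Grid.
End FixedRing.

(* Main.v *)
Require Import Defs.
From mathcomp Require Import all_boot all_order all_algebra.
From mathcomp Require Import all_classical all_reals all_analysis.
From mathcomp Require Import ring lra zify.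
Import Order.TTheory GRing.Theory Num.Theory numFieldNormedType.Exports.
Local Open Scope ring_scope.

(** Everything is read off one time step, from a curve Y to the next curve Z.
    On the edge j put a = PY' and b = PZ', the derivatives with respect to
    x in [0, 1] of the polynomials that represent Y and Z. Every derivative
    along the edge is the x-derivative multiplied by one and the same number
    s / |e|, where e is the edge vector and s = 1 or -1 records whether the
    parametrization runs with or against the orientation of the polygon
    ([dref_seg]).

    Energy. Testing the first equation with kappa and the second one with
    Z - Y eliminates the term in kappa n and leaves
      dt (grad kappa, grad kappa) + (grad Z, grad (Z - Y)) = 0.
    At a quadrature node the integrand of the last term, multiplied by the
    length element |a|, is b.(b - a) / |a|, and by Cauchy-Schwarz this is at
    least |b| - |a| ([frob_sub_ge]). Summing with positive weights bounds
    (grad Z, grad (Z - Y)) from below by the increase of the perimeter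
    ([perimeter_decrease]).

    Area. Testing the first equation with the constant 1 says that the
    quadrature of (Z - Y).(b + a)^perp vanishes: the half step normal is
    chosen so that the factor |a| of the length element cancels, and what is
    left is a polynomial of degree at most 2l - 1, which the rule integrates
    exactly. Expanding,
      (Z - Y).(b + a)^perp = Z.b^perp - Y.a^perp + (Z.a^perp - Y.b^perp),
    and the bracket is, up to sign, the derivative of the cross product of Z
    and Y ([wronskian_sub_add]). Its integrals over the edges telescope around
    the closed polygon ([sum_diff_vtx]), so that twice the areas of the two
    curves agree ([area_step]).

    The theorem follows by induction on the number of steps. *)

Section Proof.
Set Implicit Arguments.
Unset Strict Implicit.
Local Open Scope classical_set_scope.
Variable R : realType.

(** * Plane vectors *)

Lemma frobE (u v : 'rV[R]_2) : frob u v = u 0 0 * v 0 0 + u 0 1 * v 0 1.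
Proof.
rewrite /frob big_ord1 big_ord_recl big_ord1.
by rewrite (_ : lift ord0 ord0 = 1)//; exact: val_inj.
Qed.

Lemma frobC m n (A B : 'M[R]_(m, n)) : frob A B = frob B A.
Proof.
by apply: eq_bigr => i _; apply: eq_bigr => k _; rewrite mulrC.
Qed.

Lemma frobZl m n (c : R) (A B : 'M[R]_(m, n)) : frob (c *: A) B = c * frob A B.
Proof.
rewrite /frob mulr_sumr; apply: eq_bigr => i _; rewrite mulr_sumr.
by apply: eq_bigr => k _; rewrite mxE mulrA.
Qed.

Lemma frobZr m n (c : R) (A B : 'M[R]_(m, n)) : frob A (c *: B) = c * frob A B.
Proof. by rewrite frobC frobZl frobC. Qed.

Lemma frob_outer (u v a b : 'rV[R]_2) :
  frob (u^T *m a) (v^T *m b) = frob u v * frob a b.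
Proof.
rewrite /frob !big_ord1 mulr_suml; apply: eq_bigr => i _; rewrite mulr_sumr.
by apply: eq_bigr => k _; rewrite !mxE !big_ord1 !mxE mulrACA.
Qed.

Lemma frob_ge0 (u : 'rV[R]_2) : 0 <= frob u u.
Proof. by rewrite frobE addr_ge0// -expr2 sqr_ge0. Qed.

Lemma enorm_ge0 (u : 'rV[R]_2) : 0 <= enorm u.
Proof. exact: sqrtr_ge0. Qed.

Lemma enorm_sqr (u : 'rV[R]_2) : enorm u ^+ 2 = frob u u.
Proof. by rewrite sqr_sqrtr ?frob_ge0. Qed.

Lemma enormZ (c : R) (u : 'rV[R]_2) : enorm (c *: u) = `|c| * enorm u.
Proof.
by rewrite /enorm frobZl frobZr mulrA -expr2 sqrtrM ?sqr_ge0// sqrtr_sqr.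
Qed.

Lemma enorm_gt0 (u : 'rV[R]_2) : u != 0 -> 0 < enorm u.
Proof.
move=> u0; rewrite sqrtr_gt0 lt_neqAle frob_ge0 andbT eq_sym.
apply: contra u0; rewrite frobE -!expr2 paddr_eq0 ?sqr_ge0// !sqrf_eq0.
case/andP => /eqP u0 /eqP u1; apply/eqP/rowP => k; rewrite mxE.
by case: k => -[|[|//]] ?; [rewrite -[RHS]u0|rewrite -[RHS]u1];
  congr (u _ _); exact: val_inj.
Qed.

Lemma frob_le_enorm (u v : 'rV[R]_2) : frob u v <= enorm u * enorm v.
Proof.
rewrite (le_trans (ler_norm _))// -ler_sqr ?nnegrE ?mulr_ge0 ?enorm_ge0//.
rewrite real_normK ?num_real// exprMn !enorm_sqr !frobE.
(* The defect in Cauchy-Schwarz is the square of the cross product. *)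
have := sqr_ge0 (u 0 0 * v 0 1 - u 0 1 * v 0 0); nra.
Qed.

(** The convexity estimate behind the decay of the perimeter. Multiplied by |u|
    it reads |v| |u| - |u|^2 <= |v|^2 - u.v, and since u.v <= |u| |v| the two
    sides differ by at least (|v| - |u|)^2. *)
Lemma frob_sub_ge (u v : 'rV[R]_2) : enorm u != 0 ->
  enorm v - enorm u <= (enorm u)^-1 * frob v (v - u).
Proof.
move=> u0; have u_gt0 : 0 < enorm u by rewrite lt_neqAle eq_sym u0 enorm_ge0.
rewrite -ler_pdivrMl ?invr_gt0// invrK.
have -> : frob v (v - u) = enorm v ^+ 2 - frob u v.
  by rewrite enorm_sqr !frobE !mxE; ring.
have := frob_le_enorm u v; have := sqr_ge0 (enorm v - enorm u).
nra.
Qed.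

Lemma perpZ cw (c : R) (u : 'rV[R]_2) : perp cw (c *: u) = c *: perp cw u.
Proof.
by apply/rowP => k; rewrite !mxE; case: ifP; case: cw; rewrite ?mulrN.
Qed.

Definition perp_sign (cw : bool) : R := if cw then 1 else -1.

Lemma perp_sign_neq0 cw : perp_sign cw != 0.
Proof. by case: cw; rewrite /perp_sign ?oppr_eq0 oner_eq0. Qed.

Lemma frob_perp cw (u v : 'rV[R]_2) :
  frob u (perp cw v) = perp_sign cw * (u 0 0 * v 0 1 - u 0 1 * v 0 0).
Proof. by rewrite frobE !mxE /perp_sign; case: cw => /=; ring. Qed.

(** * One-sided derivatives along a segment *)

Lemma cvg_entries (T : Type) (F : set_system T) m n (f : T -> 'M[R]_(m, n))
    (A : 'M[R]_(m, n)) : Filter F ->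
  (forall i k, f t i k @[t --> F] --> A i k) -> f @ F --> A.
Proof.
move=> FF fA U [P AP PU].
have : \forall t \near F, forall i k, P i k (f t i k).
  by apply: filter_forall => i; apply: filter_forall => k; exact: fA.
by apply: filterS => t /PU.
Qed.

(** Chain rule for a line a + t v that meets S exactly along a segment, which
    x + c t in [0, 1] parametrizes. It also holds at the ends of the segment:
    there only one side of 0 is left, but increments of arbitrarily small
    size remain, so that the limit is still unique. *)
Lemma derive_in_line (V W : normedModType R) (S : set V) (f : V -> W) (a v : V)
    (g : R -> W) (dg : W) (x c : R) :
  `[0, 1]%classic x -> c != 0 ->
  (forall t, S (a + t *: v) <-> `[0, 1]%classic (x + c * t)) ->
  (forall t, `[0, 1]%classic (x + c * t) -> f (a + t *: v) = g (x + c * t)) ->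
  (fun h => h^-1 *: (g (x + h) - g x)) @ 0^' --> dg ->
  derive_in S f a v = c *: dg.
Proof.
move=> x01 c0 Sc fg gdg.
have x01' : `[0, 1]%classic (x + c * 0) by rewrite mulr0 addr0.
have fa : f a = g x by have := fg 0 x01'; rewrite scale0r mulr0 !addr0.
have PF : ProperFilter (within [set t : R | S (a + t *: v)] 0^').
  split; last exact: within_filter.
  rewrite /within/= => /nbhs_ballP[e /= e0 He].
  have [y [y01 yx xy]] : exists y : R,
      [/\ 0 <= y <= 1, y != x & `|y - x| < e * `|c|].
    have ec0 : 0 < e * `|c| by rewrite mulr_gt0 ?normr_gt0.
    (* A step of length at most 1/2 stays in [0, 1] when it is taken away
       from the nearer end. *)
    pose d := Num.min (2^-1) (2^-1 * (e * `|c|)).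
    have d0 : 0 < d by rewrite lt_min; apply/andP; split; lra.
    have d1 : d <= 2^-1 by rewrite ge_min lexx.
    have d2 : d < e * `|c| by rewrite gt_min; apply/orP; right; lra.
    move: x01 => /=; rewrite in_itv/= => /andP[x0 x1].
    have [xh|xh] := leP x (2^-1).
      exists (x + d); split; [by apply/andP; split; lra|by apply/eqP; lra|].
      by rewrite addrAC subrr add0r gtr0_norm.
    exists (x - d); split; [by apply/andP; split; lra|by apply/eqP; lra|].
    by rewrite addrAC subrr add0r normrN gtr0_norm.
  apply: (He ((y - x) / c)).
  - by rewrite /ball/= sub0r normrN normf_div ltr_pdivrMr ?normr_gt0.
  - by rewrite mulf_neq0 ?invr_eq0// subr_eq0.
  - apply/Sc; rewrite mulrC divfK// addrC subrK.
    by rewrite /= in_itv/=.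
apply/cvg_lim; first exact: norm_hausdorff.
have cc : c * t @[t --> 0^'] --> 0^'.
  have := @continuous_injective_withinNx R R ( *%R c) 0.
  by rewrite mulr0; apply; [exact: mulrl_continuous|move=> y /eqP;
    rewrite mulf_eq0 (negPf c0) => /eqP].
have lim_c := cvgZl_tmp (k := c) (FF := dnbhs_filter 0) (cvg_comp _ _ cc gdg).
have {}lim_c := @cvg_within_filter _ _ _ _ (dnbhs_filter 0) _
  [set t : R | S (a + t *: v)] lim_c.
apply: cvg_trans lim_c.
apply: near_eq_cvg; rewrite near_withinE.
near=> t => /Sc St /=.
by rewrite fg// fa scalerA invfM mulrA divff// mul1r.
Unshelve. all: by end_near. Qed.

(** * Polynomials on the unit interval *)

Definition integral01 (f : {poly R}) : R :=
  (\int[lebesgue_measure]_(x in `[0%R, 1%R]) f.[x])%R.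

Lemma poly_integrable (f : {poly R}) :
  lebesgue_measure.-integrable `[0%R, 1%R] (EFin \o horner f).
Proof.
apply: continuous_compact_integrable; first exact: segment_compact.
by apply: continuous_subspaceT => x; exact: continuous_horner.
Qed.

Lemma integral_polyD (f g : {poly R}) :
  integral01 (f + g) = integral01 f + integral01 g.
Proof.
rewrite /integral01; under eq_Rintegral do rewrite hornerD.
by rewrite RintegralD//; exact: poly_integrable.
Qed.

Lemma integral_polyB (f g : {poly R}) :
  integral01 (f - g) = integral01 f - integral01 g.
Proof. by apply/eqP; rewrite eq_sym subr_eq -integral_polyD subrK. Qed.

Lemma integral_polyZ (c : R) (f : {poly R}) :
  integral01 (c *: f) = c * integral01 f.
Proof.
rewrite /integral01; under eq_Rintegral do rewrite hornerZ.
by rewrite RintegralZl//; exact: poly_integrable.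
Qed.

Lemma integral_deriv (f : {poly R}) : integral01 (deriv f) = f.[1] - f.[0].
Proof.
rewrite /integral01 /Rintegral (@continuous_FTC2 _ _ (horner f))//.
- by apply: continuous_subspaceT => x; exact: continuous_horner.
- split; first by move=> x _; exact: derivable_horner.
    by apply: cvg_at_right_filter; exact: continuous_horner.
  by apply: cvg_at_left_filter; exact: continuous_horner.
- by move=> x _; rewrite derivE.
Qed.

Definition row_horner (p : 'I_2 -> {poly R}) (x : R) : 'rV[R]_2 :=
  \row_k (p k).[x].

Definition row_deriv (p : 'I_2 -> {poly R}) : 'I_2 -> {poly R} :=
  fun k => deriv (p k).

Lemma diff_quotient_row_horner (p : 'I_2 -> {poly R}) x :
  (fun h => h^-1 *: (row_horner p (x + h) - row_horner p x)) @ 0^' -->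
  row_horner (row_deriv p) x.
Proof.
apply: cvg_entries => i k; rewrite mxE.
have [dp <-] := is_derive_poly (p k) x.
apply: cvg_trans dp; apply: near_eq_cvg; near=> h.
by rewrite /= !mxE [h *: 1]mulr1 [h + x]addrC.
Unshelve. all: by end_near. Qed.

(** The integral of [wronskian p p] over [0, 1] is twice the signed area that
    the vector p sweeps out, the contribution of one edge to [area]. *)
Definition wronskian (p r : 'I_2 -> {poly R}) : {poly R} :=
  p 0 * deriv (r 1) - p 1 * deriv (r 0).

Lemma frob_perp_deriv cw (p r : 'I_2 -> {poly R}) x :
  frob (row_horner p x) (perp cw (row_horner (row_deriv r) x)) =
  perp_sign cw * (wronskian p r).[x].
Proof. by rewrite frob_perp !mxE /wronskian hornerD hornerN !hornerM. Qed.

(** The mixed terms of the bilinear form [wronskian] at (r - p, r + p) form an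
    exact derivative, by the Leibniz rule. This is what the average of the old
    and the new tangent in the half step normal achieves. *)
Lemma wronskian_sub_add (p r : 'I_2 -> {poly R}) :
  wronskian (fun k => r k - p k) (fun k => r k + p k) =
  wronskian r r - wronskian p p + deriv (r 0 * p 1 - r 1 * p 0).
Proof. rewrite /wronskian derivB !derivM !derivD; ring. Qed.

Lemma size_wronskian l (p r : 'I_2 -> {poly R}) :
  (forall k, (size (p k) <= l.+1)%N) -> (forall k, (size (r k) <= l.+1)%N) ->
  (size (wronskian p r) <= (2 * l - 1).+1)%N.
Proof.
move=> sp sr.
have s k k' : (size (p k * deriv (r k'))%R <= (2 * l - 1).+1)%N.
  have [->|r0] := eqVneq (deriv (r k')) 0; first by rewrite mulr0 size_poly0.
  rewrite (leq_trans (size_polyMleq _ _))//.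
  have lr : (size (deriv (r k')) < l.+1)%N.
    rewrite (leq_trans _ (sr k'))// lt_size_deriv//.
    by apply: contra r0 => /eqP ->; rewrite deriv0.
  by have := sp k; rewrite -size_poly_gt0 in r0; lia.
by rewrite (leq_trans (size_polyD _ _))// size_polyN geq_max !s.
Qed.

(** * The reference polygon *)

Section Grid.
Variables (N : nat) (G : ref_grid R N).

Definition edge_vec (j : 'I_N) : 'rV[R]_2 := seg G j 1 - seg G j 0.

(** The two cases of [seg_ends] exclude each other, because [seg G j] is
    injective; its starting point tells them apart. *)
Definition edge_sign (j : 'I_N) : R := if seg G j 0 == vtx G j then 1 else -1.

Lemma segE j x : seg G j x = seg G j 0 + x *: edge_vec j.
Proof.
have [a [b ab]] := seg_affine G j.
by rewrite /edge_vec !ab scale0r scale1r addr0 [a + b]addrC addrK.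
Qed.

Lemma edge_vec_neq0 j : edge_vec j != 0.
Proof.
by rewrite subr_eq0; apply/eqP => /seg_inj /eqP; rewrite oner_eq0.
Qed.

Lemma norm_edge_sign j : `|edge_sign j| = 1.
Proof. by rewrite /edge_sign; case: ifP; rewrite ?normrN normr1. Qed.

Lemma edge_scale_neq0 j : edge_sign j / enorm (edge_vec j) != 0.
Proof.
rewrite mulf_neq0//; first by rewrite -normr_eq0 norm_edge_sign oner_eq0.
by rewrite invr_eq0 gt_eqF ?enorm_gt0 ?edge_vec_neq0.
Qed.

Lemma diff_vtx (V : lmodType R) (f : 'rV[R]_2 -> V) j :
  f (vtx G (ordS j)) - f (vtx G j) =
  edge_sign j *: (f (seg G j 1) - f (seg G j 0)).
Proof.
rewrite /edge_sign; have [[-> ->]|[s0 s1]] := seg_ends G j.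
  by rewrite eqxx scale1r.
have := edge_vec_neq0 j; rewrite /edge_vec subr_eq0 s1 eq_sym s0 => /negPf ->.
by rewrite scaleN1r opprB.
Qed.

(** The polygon is closed, so that increments over its oriented edges cancel. *)
Lemma sum_diff_vtx (f : 'rV[R]_2 -> R) :
  \sum_(j < N) edge_sign j * (f (seg G j 1) - f (seg G j 0)) = 0.
Proof.
under eq_bigr => j _ do rewrite -[_ * _](diff_vtx (f : _ -> R^o)).
by rewrite big_split/= sumrN [X in _ - X](reindex_inj (@ordS_inj N)) /= subrr.
Qed.

Lemma ref_tangentE j :
  ref_tangent G j = (edge_sign j / enorm (edge_vec j)) *: edge_vec j.
Proof.
rewrite /ref_tangent (@diff_vtx _ id) enormZ norm_edge_sign mul1r.
by rewrite scalerA mulrC.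
Qed.

Lemma edge_seg j y : edge G j (seg G j y) <-> `[0, 1]%classic y.
Proof.
split; last by move=> y01; exists y.
by move=> [z z01 /seg_inj <-].
Qed.

Lemma dref_seg (W : normedModType R) (f : 'rV[R]_2 -> W) j g dg x :
  (forall y, `[0, 1]%classic y -> f (seg G j y) = g y) ->
  `[0, 1]%classic x ->
  (fun h => h^-1 *: (g (x + h) - g x)) @ 0^' --> dg ->
  dref G f j (seg G j x) = (edge_sign j / enorm (edge_vec j)) *: dg.
Proof.
move=> fg x01 gdg.
have along_edge t : seg G j x + t *: ref_tangent G j =
    seg G j (x + edge_sign j / enorm (edge_vec j) * t).
  rewrite ref_tangentE scalerA !(segE _ (_ + _)) segE scalerDl addrA.
  by rewrite [t * _]mulrC.
apply: (@derive_in_line _ _ _ _ _ _ g _ x) => //.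
- exact: edge_scale_neq0.
- by move=> t; rewrite along_edge; exact: edge_seg.
- by move=> t t01; rewrite along_edge fg.
Qed.

Lemma element_grad_seg (Y : 'rV[R]_2 -> 'rV[R]_2) j g dg x :
  (forall y, `[0, 1]%classic y -> Y (seg G j y) = g y) ->
  `[0, 1]%classic x ->
  (fun h => h^-1 *: (g (x + h) - g x)) @ 0^' --> dg ->
  element_grad G Y j x = dg.
Proof.
move=> Yg x01 gdg; rewrite -[RHS]scale1r.
apply: (@derive_in_line R _ _ _ _ _ g _ x) => //.
- by move=> t; rewrite [_ *: 1]mulr1 mul1r.
- by move=> t t01; rewrite [_ *: 1]mulr1 mul1r in t01 *; exact: Yg.
Qed.

(** * Finite element functions *)

Definition pulls_back_to (Y : 'rV[R]_2 -> 'rV[R]_2)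
    (P : 'I_N -> 'I_2 -> {poly R}) :=
  forall j x, `[0, 1]%classic x -> Y (seg G j x) = row_horner (P j) x.

Lemma fe_space2_poly l Y : fe_space2 G l Y ->
  exists2 P, pulls_back_to Y P & forall j k, (size (P j k) <= l.+1)%N.
Proof.
move=> Yfe.
have /choice[P HP] : forall jk : 'I_N * 'I_2, exists p : {poly R},
    (size p <= l.+1)%N /\
    forall x, `[0, 1]%classic x -> Y (seg G jk.1 x) 0 jk.2 = p.[x].
  by move=> [j k]; have [_ /(_ j)[p sp Yp]] := Yfe k; exists p.
exists (fun j k => P (j, k)) => [j x x01|j k]; last by have [] := HP (j, k).
by apply/rowP => k; rewrite mxE; have [_ ->] := HP (j, k).
Qed.

Lemma fe_space_cst l (c : R) : fe_space G l (fun=> c).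
Proof.
split=> [|j]; first by move=> x; exact: cvg_cst.
exists c%:P => [|x _]; last by rewrite hornerC.
by rewrite (leq_trans (size_polyC_leq1 _)).
Qed.

Lemma fe_spaceB l (f g : 'rV[R]_2 -> R) :
  fe_space G l f -> fe_space G l g -> fe_space G l (fun z => f z - g z).
Proof.
move=> [cf pf] [cg pg]; split=> [|j]; first exact: within_continuousB.
have [p sp fp] := pf j; have [r sr gr] := pg j.
exists (p - r) => [|x x01]; last by rewrite fp// gr// hornerD hornerN.
by rewrite (leq_trans (size_polyD _ _))// size_polyN geq_max sp sr.
Qed.

Lemma dref_poly Y P j x : pulls_back_to Y P -> `[0, 1]%classic x ->
  dref G Y j (seg G j x) =
  (edge_sign j / enorm (edge_vec j)) *: row_horner (row_deriv (P j)) x.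
Proof.
move=> YP x01.
apply: (@dref_seg _ _ _ (row_horner (P j))) => //; first exact: YP.
exact: diff_quotient_row_horner.
Qed.

Lemma element_grad_poly Y P j x : pulls_back_to Y P -> `[0, 1]%classic x ->
  element_grad G Y j x = row_horner (row_deriv (P j)) x.
Proof.
move=> YP x01; apply: (@element_grad_seg _ _ (row_horner (P j))) => //.
  exact: YP.
exact: diff_quotient_row_horner.
Qed.

Lemma sgrad_cst Y (c : R) j x : `[0, 1]%classic x ->
  sgrad G Y (fun=> c) j (seg G j x) = 0.
Proof.
move=> x01; rewrite /sgrad /dtangent.
rewrite (@dref_seg _ _ _ (fun=> c) 0)// ?scaler0 ?scale0r//.
by under eq_cvg do rewrite subrr scaler0; exact: cvg_cst.
Qed.

Lemma pulls_back_toB Y Z PY PZ : pulls_back_to Y PY -> pulls_back_to Z PZ ->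
  pulls_back_to (fun z => Z z - Y z) (fun j k => PZ j k - PY j k).
Proof.
move=> YP ZP j x x01; apply/rowP => k.
by rewrite YP// ZP// !mxE hornerD hornerN.
Qed.

Lemma areaE Y P cw : pulls_back_to Y P ->
  area G Y cw = 2^-1 * perp_sign cw *
    \sum_(j < N) edge_sign j * integral01 (wronskian (P j) (P j)).
Proof.
move=> YP; rewrite /area /curve_integral -mulrA; congr (_ * _).
rewrite mulr_sumr; apply: eq_bigr => j _; rewrite mulrA -integral_polyZ.
apply: eq_Rintegral => x; rewrite inE => x01.
rewrite (dref_poly _ YP)// YP// perpZ frobZr frob_perp_deriv hornerZ.
rewrite -/(edge_vec j) mulrAC divfK; last first.
  by rewrite gt_eqF ?enorm_gt0 ?edge_vec_neq0.
by rewrite [LHS]mulrA [_ * perp_sign _]mulrC.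
Qed.

(** All gradients carry the same scale s / |e|, which cancels; what is left
    is [frob_sub_ge] for the x-derivatives of Y and Z. *)
Lemma edge_perimeter_decrease Y Z PY PZ j x :
  pulls_back_to Y PY -> pulls_back_to Z PZ -> `[0, 1]%classic x ->
  0 < enorm (element_grad G Y j x) ->
  enorm (element_grad G Z j x) - enorm (element_grad G Y j x) <=
  frob (sgrad2 G Y Z j (seg G j x))
       (sgrad2 G Y (fun z => Z z - Y z) j (seg G j x)) *
    enorm (element_grad G Y j x).
Proof.
move=> YP ZP x01; rewrite (element_grad_poly _ YP)// (element_grad_poly _ ZP)//.
set a := row_horner _ x; set b := row_horner _ x => a0.
pose c := edge_sign j / enorm (edge_vec j).
have dZY : dref G (fun z => Z z - Y z) j (seg G j x) = c *: (b - a).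
  rewrite (dref_poly _ (pulls_back_toB YP ZP))//; congr (_ *: _).
  by apply/rowP => k; rewrite !mxE /row_deriv derivB hornerD hornerN.
rewrite /sgrad2 /dtangent /tangent dZY (dref_poly _ YP)// (dref_poly _ ZP)//.
rewrite frob_outer -/c -/a -/b enormZ !scalerA !frobZl !frobZr -enorm_sqr.
have c0 : `|c| != 0 by rewrite normr_eq0 edge_scale_neq0.
have := frob_sub_ge b (lt0r_neq0 a0).
have -> : (enorm a)^-1 * frob b (b - a) =
    (c / `|c|) ^+ 2 * (c / `|c|) ^+ 2 * ((enorm a)^-1 * frob b (b - a)).
  rewrite expr_div_n real_normK ?num_real// divff ?mul1r//.
  by rewrite expf_neq0// edge_scale_neq0.
move=> /le_trans; apply; rewrite le_eqVlt; apply/orP; left; apply/eqP.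
by field; rewrite c0 lt0r_neq0.
Qed.

Lemma quad_ipZl Y Q (q : quad_rule R Q) (c : R) (f : 'rV[R]_2 -> 'rV[R]_2)
    (g : piecewise R N 'rV[R]_2) :
  quad_ip G Y (@frob R 1 2) q (pw (fun z => c *: f z)) g =
  c * quad_ip G Y (@frob R 1 2) q (pw f) g.
Proof.
rewrite /quad_ip /quad mulr_sumr; apply: eq_bigr => j _; rewrite mulr_sumr.
by apply: eq_bigr => i _; rewrite /pw frobZl !mulrA.
Qed.

Lemma quad_ip_frobC Y Q (q : quad_rule R Q) m n
    (f g : piecewise R N 'M[R]_(m, n)) :
  quad_ip G Y (@frob R m n) q f g = quad_ip G Y (@frob R m n) q g f.
Proof.
by apply: eq_bigr => j _; apply: eq_bigr => i _; rewrite frobC.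
Qed.

(** * One time step *)

Section Step.
Variables (cw : bool) (l Q : nat) (q : quad_rule R Q) (dt : R).
Variables (Y Z : 'rV[R]_2 -> 'rV[R]_2) (kappa : 'rV[R]_2 -> R).
Hypotheses (dt_gt0 : 0 < dt) (Y_fe : fe_space2 G l Y).
Hypotheses (Y_A1h : assumption_A1h G Y q).
Hypothesis (Z_scheme : scheme_solution G Y cw l q dt Z kappa).

Lemma perimeter_decrease :
  perimeter_h G Z q - perimeter_h G Y q <=
  quad_ip G Y (@frob R 2 2) q (sgrad2 G Y Z) (sgrad2 G Y (fun z => Z z - Y z)).
Proof.
have [PY YP _] := fe_space2_poly Y_fe.
have [Z_fe _ _ _] := Z_scheme; have [PZ ZP _] := fe_space2_poly Z_fe.
rewrite /perimeter_h /quad_ip -sumrB; apply: ler_sum => j _.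
rewrite /quad -sumrB; apply: ler_sum => i _.
rewrite -mulrBl ler_wpM2r ?(ltW (weight_gt0 _ _))// /pw mulr1 !mul1r.
by apply: (edge_perimeter_decrease YP ZP) => //; exact: node_in.
Qed.

Lemma energy_step :
  perimeter_h G Z q + dt *
    quad_ip G Y (@frob R 1 2) q (sgrad G Y kappa) (sgrad G Y kappa)
  <= perimeter_h G Y q.
Proof.
have [Z_fe kappa_fe normal_eq curvature_eq] := Z_scheme.
have := normal_eq _ kappa_fe; move/eqP; rewrite subr_eq0 => /eqP <-.
have ZY_fe : fe_space2 G l (fun z => Z z - Y z).
  move=> k; have -> : (fun z => (Z z - Y z) 0 k) = (fun z => Z z 0 k - Y z 0 k).
    by apply/funext => z; rewrite !mxE.
  exact: fe_spaceB.
have := curvature_eq _ ZY_fe; rewrite quad_ip_frobC => /eqP.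
rewrite addr_eq0 quad_ipZl mulVKf ?(gt_eqF dt_gt0)// => /eqP ->.
by rewrite lerBlDr -lerBlDl perimeter_decrease.
Qed.

Lemma area_step : exact_to_degree q (2 * l - 1) -> area G Z cw = area G Y cw.
Proof.
move=> q_exact.
have [PY YP sY] := fe_space2_poly Y_fe.
have [Z_fe _ normal_eq _] := Z_scheme; have [PZ ZP sZ] := fe_space2_poly Z_fe.
pose W j := wronskian (fun k => PZ j k - PY j k) (fun k => PZ j k + PY j k).
have size_BD (a b : {poly R}) : (size a <= l.+1)%N -> (size b <= l.+1)%N ->
    (size (a - b)%R <= l.+1)%N /\ (size (a + b)%R <= l.+1)%N.
  move=> sa sb; split; rewrite (leq_trans (size_polyD _ _))// ?size_polyN;
  by rewrite geq_max sa sb.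
have sum0 : \sum_(j < N) edge_sign j * integral01 (W j) = 0.
  have := normal_eq _ (fe_space_cst l 1).
  have -> : quad_ip G Y (@frob R 1 2) q (sgrad G Y kappa)
      (sgrad G Y (fun=> 1)) = 0.
    rewrite /quad_ip big1// => j _; rewrite /quad big1// => i _.
    rewrite sgrad_cst; last exact: node_in.
    by rewrite -[X in frob _ X](scale0r 0) frobZr !mul0r.
  rewrite subr0 quad_ipZl => /eqP.
  rewrite mulf_eq0 invr_eq0 (gt_eqF dt_gt0)/= => /eqP.
  have -> : quad_ip G Y (@frob R 1 2) q (pw (fun z => Z z - Y z))
      (fun j z => 1 *: half_normal G Y cw Z j z) =
      2^-1 * perp_sign cw * \sum_(j < N) edge_sign j * integral01 (W j).
    rewrite mulr_sumr; apply: eq_bigr => j _.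
    rewrite /integral01 -q_exact; last first.
      by apply: size_wronskian => k; have [] := size_BD _ _ (sZ j k) (sY j k).
    rewrite /quad !mulr_sumr; apply: eq_bigr => i _.
    rewrite !mulrA; congr (_ * _).
    have x01 := node_in q i; have grad_gt0 := Y_A1h j i.
    rewrite /half_normal /pw (pulls_back_toB YP ZP)// scale1r frobZr.
    rewrite (dref_poly _ YP)// (dref_poly _ ZP)//.
    rewrite (element_grad_poly _ YP)// in grad_gt0 *.
    rewrite -scalerDr perpZ frobZr enormZ normrM normfV norm_edge_sign mul1r.
    have -> : row_horner (row_deriv (PZ j)) (node q i) +
        row_horner (row_deriv (PY j)) (node q i) =
        row_horner (row_deriv (fun k => PZ j k + PY j k)) (node q i).
      by apply/rowP => k; rewrite !mxE /row_deriv derivD hornerD.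
    rewrite frob_perp_deriv -/(W j) ger0_norm ?enorm_ge0//.
    have edge_gt0 := enorm_gt0 (edge_vec_neq0 j).
    by field; rewrite !gt_eqF.
  move/eqP; rewrite mulf_eq0 => /orP[|/eqP//].
  by rewrite mulf_eq0 invr_eq0 pnatr_eq0 (negPf (perp_sign_neq0 cw)).
rewrite (areaE _ ZP) (areaE _ YP); congr (_ * _); apply/eqP.
rewrite -subr_eq0 -sumrB -[X in _ == X]sum0; apply/eqP.
(* The vertex values of the cross product of Z and Y supply the boundary terms
   of the exact derivative in W. *)
have boundary0 :=
  sum_diff_vtx (fun z => Z z 0 0 * Y z 0 1 - Z z 0 1 * Y z 0 0).
rewrite -[LHS]addr0 -[X in _ + X = _]boundary0 -big_split.
apply: eq_bigr => j _ /=.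
have [in0 in1] : `[(0:R), 1] 0 /\ `[(0:R), 1] 1.
  by split; rewrite /= in_itv /= lexx ler01.
rewrite /W (wronskian_sub_add (PY j) (PZ j)) integral_polyD integral_polyB.
rewrite integral_deriv.
rewrite !(YP _ _ in0, YP _ _ in1, ZP _ _ in0, ZP _ _ in1) !mxE.
rewrite !hornerD !hornerN !hornerM; ring.
Qed.

End Step.
End Grid.
End Proof.

(** * The scheme *)

Theorem theorem2p5 (R : realType) (N : nat) (G : ref_grid R N) (cw : bool)
    (l M Q : nat) (q : quad_rule R Q) (dt : R)
    (Y : nat -> 'rV[R]_2 -> 'rV[R]_2) (kappa : nat -> 'rV[R]_2 -> R)
    (dt_gt0 : 0 < dt) (l_ge1 : (1 <= l)%N)
    (q_exact : exact_to_degree q (2 * l - 1))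
    (Y0_fe : fe_space2 G l (Y 0%N))
    (Y_A1h : forall m, (m <= M)%N -> assumption_A1h G (Y m) q)
    (Y_scheme : forall m, (m <= M)%N ->
       scheme_solution G (Y m) cw l q dt (Y m.+1) (kappa m.+1)) :
  perimeter_h G (Y M.+1) q
    + dt * \sum_(0 <= m < M.+1)
        quad_ip G (Y m) (@frob R 1 2) q
          (sgrad G (Y m) (kappa m.+1)) (sgrad G (Y m) (kappa m.+1))
    <= perimeter_h G (Y 0%N) q
  /\ forall m, (m <= M.+1)%N -> area G (Y m) cw = area G (Y 0%N) cw.
Proof.
have chain (a b c d e : R) : a + d <= b -> b + c <= e -> a + (c + d) <= e.
  by move=> ad_b; apply: le_trans; rewrite addrCA addrC lerD2r.
have Y_fe m : (m <= M.+1)%N -> fe_space2 G l (Y m).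
  by case: m => [//|m] mM; have [] := Y_scheme m mM.
split; last first.
  elim=> [//|m IHm] mM; rewrite -(IHm (ltnW mM)).
  exact: (area_step dt_gt0 (Y_fe m (ltnW mM)) (Y_A1h m mM) (Y_scheme m mM)).
elim: M Y_A1h Y_scheme Y_fe => [|M IHM] Y_A1h Y_scheme Y_fe.
  rewrite big_nat1.
  exact: (energy_step dt_gt0 (Y_fe 0%N _) (Y_A1h 0%N _) (Y_scheme 0%N _)).
have step := energy_step dt_gt0 (Y_fe M.+1 (leqnSn _)) (Y_A1h M.+1 (leqnn _))
  (Y_scheme M.+1 (leqnn _)).
rewrite [X in dt * X]big_nat_recr; last by [].
rewrite mulrDr; apply: (chain _ _ _ _ _ step).
exact: (IHM (fun m mM => Y_A1h m (leqW mM)) (fun m mM => Y_scheme m (leqW mM))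
  (fun m mM => Y_fe m (leqW mM))).
Qed.
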